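(* The function $f(x)=F\left(\begin{matrix}a\\ B\end{matrix};x\right)$ satisfies the hypergeometric differential equations $$\Bigl[\prod_{j=1}^3(b_{ij}-1+\theta_i)\Bigr]\cdot f(x)=\Bigl[x_i\prod_{j=1}^3(a_j+\theta_1+\theta_2)\Bigr]\cdot f(x)\qquad(i=1,2),$$ where $\theta_i=x_i\partial_i$ and $\partial_i=\partial/\partial x_i$.
   Context: For $\alpha\in\mathbb C$, $n\in\mathbb N=\{0,1,2,\dots\}$: $(\alpha,n)=\alpha(\alpha+1)\cdots(\alpha+n-1)$. Parameters $a=(a_1,a_2,a_3)$ and $B=\begin{pmatrix}b_{11}&b_{12}&b_{13}\\ b_{21}&b_{22}&b_{23}\end{pmatrix}=\begin{pmatrix}b_1&b_2&1\\ b_3&b_4&1\end{pmatrix}$ with $b_1,\dots,b_4\notin\{0,-1,-2,\dots\}$; $$F\left(\begin{matrix}a\\ B\end{matrix};x\right)=\sum_{n_1,n_2=0}^\infty\frac{(a_1,n_1+n_2)(a_2,n_1+n_2)(a_3,n_1+n_2)}{(b_1,n_1)(b_2,n_1)(1,n_1)(b_3,n_2)(b_4,n_2)(1,n_2)}x_1^{n_1}x_2^{n_2},$$ which converges absolutely for $\sqrt[3]{|x_1|}+\sqrt[3]{|x_2|}<1$. *)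

(* Defs.v *)
From Stdlib Require Export Reals List.
From Coquelicot Require Export Coquelicot.
Export ListNotations.
Open Scope C_scope.

(** Pochhammer symbol [(alpha, n) = alpha (alpha + 1) ... (alpha + n - 1)]. *)
Fixpoint poch (alpha : C) (n : nat) : C :=
  match n with
  | O => 1
  | S m => poch alpha m * (alpha + RtoC (INR m))
  end.

Definition poch_prod (l : list C) (n : nat) : C :=
  fold_right (fun c p => poch c n * p) 1 l.

Definition non_pole (b : C) : Prop := forall k : nat, b <> RtoC (- INR k).

(** Coquelicot's [Series] is real-valued; a complex series is summed
    componentwise. *)
Definition C_Series (u : nat -> C) : C :=
  (Series (fun n => Re (u n)), Series (fun n => Im (u n))).

Definition C_Series2 (u : nat -> nat -> C) : C :=
  C_Series (fun n1 => C_Series (fun n2 => u n1 n2)).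

Definition abs_summable2 (u : nat -> nat -> C) : Prop :=
  exists M : R, forall N1 N2 : nat,
    (sum_n (fun n1 => sum_n (fun n2 => Cmod (u n1 n2)) N2) N1 <= M)%R.

(** [B1] and [B2] are the two rows of the matrix [B]; their last entry is [1],
    which gives the factorials [(1, n1)] and [(1, n2)]. *)
Definition F_term (a B1 B2 : list C) (x1 x2 : C) (n1 n2 : nat) : C :=
  poch_prod a (n1 + n2) / (poch_prod B1 n1 * poch_prod B2 n2)
  * x1 ^ n1 * x2 ^ n2.

Definition F (a B1 B2 : list C) (x1 x2 : C) : C :=
  C_Series2 (F_term a B1 B2 x1 x2).

(** The case split is needed because [Rpower 0 y = 1] in the standard library. *)
Definition cbrt (r : R) : R :=
  if Rle_dec r 0 then 0%R else Rpower r (1 / 3).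

Definition F_domain (x1 x2 : C) : Prop :=
  (cbrt (Cmod x1) + cbrt (Cmod x2) < 1)%R.

Definition partial1 (f : C -> C -> C) : C -> C -> C :=
  fun x1 x2 => C_derive (fun t => f t x2) x1.
Definition partial2 (f : C -> C -> C) : C -> C -> C :=
  fun x1 x2 => C_derive (fun t => f x1 t) x2.

(** Every iterated complex partial derivative of [f] of order at most [k], in
    any order of the variables, exists at every point of [D].  Since [C_derive]
    is total, this is what gives [partial1] and [partial2] their meaning. *)
Fixpoint C_derivable_upto (k : nat) (D : C -> C -> Prop) (f : C -> C -> C) : Prop :=
  match k with
  | O => True
  | S k' =>
      (forall x1 x2, D x1 x2 ->
         ex_derive (fun t : C => f t x2) x1 /\ ex_derive (fun t : C => f x1 t) x2)
      /\ C_derivable_upto k' D (partial1 f)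
      /\ C_derivable_upto k' D (partial2 f)
  end.

Definition Op : Type := (C -> C -> C) -> (C -> C -> C).

Definition op_add (S T : Op) : Op := fun f x1 x2 => S f x1 x2 + T f x1 x2.
Definition op_comp (S T : Op) : Op := fun f => S (T f).
Definition op_const (c : C) : Op := fun f x1 x2 => c * f x1 x2.
Definition op_x1 : Op := fun f x1 x2 => x1 * f x1 x2.
Definition op_x2 : Op := fun f x1 x2 => x2 * f x1 x2.
Definition op_prod (l : list Op) : Op := fold_right op_comp (fun f => f) l.

Definition theta1 : Op := op_comp op_x1 partial1.
Definition theta2 : Op := op_comp op_x2 partial2.

(* Main.v *)
Require Import Defs.
From Stdlib Require Import Lra Lia.

(** Write [c n1 n2] for the coefficients of the series.  On a double power
    series the Euler operator [theta1] multiplies the coefficient of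
    [x1 ^ n1 * x2 ^ n2] by [n1], [theta2] multiplies it by [n2], and
    multiplication by [x1] shifts it by one place.  Both sides of the first
    equation are therefore power series, and they agree as soon as

      [(b1 + n) (b2 + n) (1 + n) * c (n + 1) m
         = (a1 + n + m) (a2 + n + m) (a3 + n + m) * c n m],

    which is the recurrence of the Pochhammer symbols
    ([hypergeom_coeff_recurrence]); the terms with [n1 = 0], absent on the right,
    vanish on the left because of the entry [1] in [B1]
    ([hypergeom_coeff_balance]).  The second equation is the same with the
    variables exchanged.

    The analytic content is that this formal computation is legitimate on the
    domain.  It rests on a stable notion of convergence ([converges_on]): near
    every point, with both radii slightly enlarged, the terms are dominated by a
    geometric double sequence.  This passes to sums, shifts and formal
    derivatives, and it allows termwise differentiation with a direct quadratic
    bound for the remainder ([is_derive_C_Series2]).  The bound treats the two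
    summation indices alike, so the order of summation is never exchanged.  The
    predicate [represents D f c] says that [f] is on [D] the sum of the series
    with coefficients [c]; it is preserved by all operators involved, which gives
    the existence of all iterated derivatives ([represents_derivable_upto]) and
    reduces products of operators to products of their symbols
    ([has_symbol_prod]).

    That the hypergeometric coefficients converge on the domain
    ([hypergeom_coeff_converges]) comes from two estimates.  Up to a factor
    [q ^ n] with [q > 1] arbitrary, every Pochhammer symbol [(b, n)] behaves like
    [n!] ([poch_ratio_bound]), so [c n1 n2] is at most the cube of the binomial
    coefficient times [q ^ (2 (n1 + n2))].  And if [Cmod xi <= si ^ 3], a single
    term of the binomial expansion of [(s1 + s2) ^ (n1 + n2)] is at most the whole
    ([multinomial_le]); its cube is the bound wanted. *)

(** * Geometrically dominated complex series *)

Lemma re_im_le_Cmod (z : C) : (Rabs (Re z) <= Cmod z /\ Rabs (Im z) <= Cmod z)%R.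
Proof.
  pose proof (Rmax_Cmod z) as H. unfold Re, Im. split; eapply Rle_trans; try exact H.
  - apply Rmax_l.
  - apply Rmax_r.
Qed.

Lemma Cmod_le_re_im (z : C) : (Cmod z <= Rabs (Re z) + Rabs (Im z))%R.
Proof.
  destruct z as [x y]. replace (x, y) with (RtoC x + Ci * RtoC y).
  2: { unfold Ci, RtoC, Cplus, Cmult; simpl. f_equal; ring. }
  eapply Rle_trans. { apply Cmod_triangle. }
  rewrite Cmod_mult, Cmod_Ci, !Cmod_R. unfold Ci, RtoC, Re, Im; simpl.
  replace (x + (0 * y - 1 * 0))%R with x by ring.
  replace (0 + (0 * 0 + 1 * y))%R with y by ring. lra.
Qed.

Definition geom_bounded (M rho : R) (u : nat -> C) : Prop :=
  forall n, (Cmod (u n) <= M * rho ^ n)%R.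

Definition geom_bounded2 (M rho : R) (u : nat -> nat -> C) : Prop :=
  forall n1 n2, (Cmod (u n1 n2) <= M * rho ^ n1 * rho ^ n2)%R.

Lemma ex_series_geom_scal (M rho : R) :
  (0 <= rho < 1)%R -> ex_series (fun n => (M * rho ^ n)%R).
Proof.
  intros H. apply (ex_series_scal_l (K := R_AbsRing) (V := R_NormedModule) M).
  apply ex_series_geom. rewrite Rabs_pos_eq; lra.
Qed.

Lemma real_series_geom_bounded (M rho : R) (a : nat -> R) :
  (0 <= rho < 1)%R -> (forall n, (Rabs (a n) <= M * rho ^ n)%R) ->
  ex_series a /\ (Rabs (Series a) <= M / (1 - rho))%R.
Proof.
  intros H Ha.
  pose proof (ex_series_geom_scal M rho H) as Hg.
  assert (Habs : ex_series (fun n => Rabs (a n))).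
  { apply (ex_series_le (K := R_AbsRing) (V := R_CompleteNormedModule)
             _ (fun n => (M * rho ^ n)%R)); [|exact Hg].
    intros n. change (Rabs (Rabs (a n)) <= M * rho ^ n)%R.
    rewrite Rabs_Rabsolu. apply Ha. }
  split. { apply ex_series_Rabs, Habs. }
  eapply Rle_trans. { apply Series_Rabs, Habs. }
  eapply Rle_trans.
  { apply Series_le with (b := fun n => (M * rho ^ n)%R); [|exact Hg].
    intros n; split; [apply Rabs_pos | apply Ha]. }
  rewrite Series_scal_l, Series_geom; [apply Rle_refl|].
  rewrite Rabs_pos_eq; lra.
Qed.

Lemma geom_bounded_components (M rho : R) (u : nat -> C) :
  (0 <= rho < 1)%R -> geom_bounded M rho u ->
  ex_series (fun n => Re (u n)) /\ ex_series (fun n => Im (u n)) /\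
  (Rabs (Series (fun n => Re (u n))) <= M / (1 - rho))%R /\
  (Rabs (Series (fun n => Im (u n))) <= M / (1 - rho))%R.
Proof.
  intros H Hu.
  destruct (real_series_geom_bounded M rho (fun n => Re (u n)) H) as [? ?].
  { intros n. eapply Rle_trans; [apply re_im_le_Cmod | apply Hu]. }
  destruct (real_series_geom_bounded M rho (fun n => Im (u n)) H) as [? ?].
  { intros n. eapply Rle_trans; [apply re_im_le_Cmod | apply Hu]. }
  auto.
Qed.

Lemma Cmod_C_Series_le (M rho : R) (u : nat -> C) :
  (0 <= rho < 1)%R -> geom_bounded M rho u ->
  (Cmod (C_Series u) <= 2 / (1 - rho) * M)%R.
Proof.
  intros H Hu. destruct (geom_bounded_components M rho u H Hu) as (_ & _ & H1 & H2).
  eapply Rle_trans. { apply Cmod_le_re_im. }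
  unfold C_Series; simpl. unfold Rdiv in *. lra.
Qed.

Lemma C_Series_ext (u v : nat -> C) :
  (forall n, u n = v n) -> C_Series u = C_Series v.
Proof.
  intros H. unfold C_Series. f_equal; apply Series_ext; intros n; now rewrite H.
Qed.

Lemma C_Series_plus (M rho N sigma : R) (u v : nat -> C) :
  (0 <= rho < 1)%R -> geom_bounded M rho u ->
  (0 <= sigma < 1)%R -> geom_bounded N sigma v ->
  C_Series (fun n => u n + v n) = C_Series u + C_Series v.
Proof.
  intros Hr Hu Hs Hv.
  destruct (geom_bounded_components M rho u Hr Hu) as (? & ? & _).
  destruct (geom_bounded_components N sigma v Hs Hv) as (? & ? & _).
  unfold C_Series, Cplus; simpl. f_equal; now apply Series_plus.
Qed.

Lemma C_Series_scal (M rho : R) (a : C) (u : nat -> C) :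
  (0 <= rho < 1)%R -> geom_bounded M rho u ->
  C_Series (fun n => a * u n) = a * C_Series u.
Proof.
  intros Hr Hu.
  destruct (geom_bounded_components M rho u Hr Hu) as (? & ? & _).
  unfold C_Series, Cmult; simpl. f_equal.
  - rewrite Series_minus, !Series_scal_l; [reflexivity| |];
      now apply (ex_series_scal_l (K := R_AbsRing) (V := R_NormedModule)).
  - rewrite Series_plus, !Series_scal_l; [reflexivity| |];
      now apply (ex_series_scal_l (K := R_AbsRing) (V := R_NormedModule)).
Qed.

Lemma C_Series_shift (u : nat -> C) :
  u O = 0 -> C_Series u = C_Series (fun n => u (S n)).
Proof.
  intros H. unfold C_Series.
  f_equal; apply Series_incr_1_aux; now rewrite H.
Qed.

Lemma C_Series_0 : C_Series (fun _ => 0) = 0.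
Proof.
  unfold C_Series. simpl.
  assert (E : Series (fun _ => 0%R) = 0%R).
  { rewrite (Series_ext _ (fun n => (0 * 0)%R)) by (intros; ring).
    rewrite Series_scal_l. ring. }
  now rewrite E.
Qed.

(** * Double series *)

Lemma geom_bounded2_row (M rho : R) (u : nat -> nat -> C) (n1 : nat) :
  geom_bounded2 M rho u -> geom_bounded (M * rho ^ n1) rho (u n1).
Proof. intros H n2. apply H. Qed.

Lemma geom_bounded2_row_sums (M rho : R) (u : nat -> nat -> C) :
  (0 <= rho < 1)%R -> geom_bounded2 M rho u ->
  geom_bounded (2 / (1 - rho) * M) rho (fun n1 => C_Series (u n1)).
Proof.
  intros H Hu n1.
  eapply Rle_trans. { apply Cmod_C_Series_le, geom_bounded2_row, Hu; exact H. }
  apply Req_le. ring.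
Qed.

(** The linear dependence on [M] is what turns a termwise quadratic bound into a
    quadratic bound on the sum. *)
Lemma Cmod_C_Series2_le (M rho : R) (u : nat -> nat -> C) :
  (0 <= rho < 1)%R -> geom_bounded2 M rho u ->
  (Cmod (C_Series2 u) <= (2 / (1 - rho)) ^ 2 * M)%R.
Proof.
  intros H Hu. unfold C_Series2.
  eapply Rle_trans.
  { apply Cmod_C_Series_le, geom_bounded2_row_sums, Hu; exact H. }
  apply Req_le. ring.
Qed.

Lemma C_Series2_ext (u v : nat -> nat -> C) :
  (forall n1 n2, u n1 n2 = v n1 n2) -> C_Series2 u = C_Series2 v.
Proof. intros H. apply C_Series_ext; intros n1. apply C_Series_ext, H. Qed.

Lemma C_Series2_plus (M rho N sigma : R) (u v : nat -> nat -> C) :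
  (0 <= rho < 1)%R -> geom_bounded2 M rho u ->
  (0 <= sigma < 1)%R -> geom_bounded2 N sigma v ->
  C_Series2 (fun n1 n2 => u n1 n2 + v n1 n2) = C_Series2 u + C_Series2 v.
Proof.
  intros Hr Hu Hs Hv. unfold C_Series2.
  etransitivity.
  2: exact (C_Series_plus _ _ _ _ _ _ Hr (geom_bounded2_row_sums _ _ _ Hr Hu)
              Hs (geom_bounded2_row_sums _ _ _ Hs Hv)).
  apply C_Series_ext; intros n1.
  exact (C_Series_plus _ _ _ _ _ _ Hr (geom_bounded2_row _ _ _ n1 Hu)
           Hs (geom_bounded2_row _ _ _ n1 Hv)).
Qed.

Lemma C_Series2_scal (M rho : R) (a : C) (u : nat -> nat -> C) :
  (0 <= rho < 1)%R -> geom_bounded2 M rho u ->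
  C_Series2 (fun n1 n2 => a * u n1 n2) = a * C_Series2 u.
Proof.
  intros Hr Hu. unfold C_Series2.
  etransitivity.
  2: exact (C_Series_scal _ _ _ _ Hr (geom_bounded2_row_sums _ _ _ Hr Hu)).
  apply C_Series_ext; intros n1.
  exact (C_Series_scal _ _ _ _ Hr (geom_bounded2_row _ _ _ n1 Hu)).
Qed.

Lemma C_Series2_shift1 (u : nat -> nat -> C) :
  (forall n2, u O n2 = 0) -> C_Series2 u = C_Series2 (fun n1 n2 => u (S n1) n2).
Proof.
  intros H. unfold C_Series2.
  apply (C_Series_shift (fun n1 => C_Series (fun n2 => u n1 n2))).
  rewrite <- C_Series_0. apply C_Series_ext, H.
Qed.

Lemma C_Series2_shift2 (u : nat -> nat -> C) :
  (forall n1, u n1 O = 0) -> C_Series2 u = C_Series2 (fun n1 n2 => u n1 (S n2)).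
Proof.
  intros H. apply C_Series_ext; intros n1.
  apply (C_Series_shift (u n1)), H.
Qed.

(** * Absolute summability *)

Lemma sum_n_geom_le (M rho : R) (a : nat -> R) (N : nat) :
  (0 <= rho < 1)%R -> (forall n, (0 <= a n <= M * rho ^ n)%R) ->
  (sum_n a N <= M / (1 - rho))%R.
Proof.
  intros H Ha.
  assert (HM : (0 <= M)%R). { destruct (Ha O) as [h1 h2]. simpl in h2. lra. }
  apply Rle_trans with (M * ((1 - rho ^ S N) / (1 - rho)))%R.
  - induction N as [|N IH].
    + rewrite sum_O. destruct (Ha O) as [_ h]. simpl in *.
      replace ((1 - rho * 1) / (1 - rho))%R with 1%R by (field; lra). lra.
    + rewrite sum_Sn. change (sum_n a N + a (S N) <= M * ((1 - rho ^ S (S N)) / (1 - rho)))%R.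
      destruct (Ha (S N)) as [_ h].
      replace (M * ((1 - rho ^ S (S N)) / (1 - rho)))%R
        with (M * ((1 - rho ^ S N) / (1 - rho)) + M * rho ^ S N)%R
        by (simpl; field; lra).
      lra.
  - apply Rmult_le_compat_l; [exact HM|].
    unfold Rdiv. rewrite <- (Rmult_1_l (/ (1 - rho))) at 2.
    apply Rmult_le_compat_r. { left; apply Rinv_0_lt_compat; lra. }
    pose proof (pow_le rho (S N) (proj1 H)). lra.
Qed.

Lemma sum_n_nonneg (a : nat -> R) (N : nat) :
  (forall n, (0 <= a n)%R) -> (0 <= sum_n a N)%R.
Proof.
  intros H. induction N as [|N IH]; [rewrite sum_O; apply H|].
  rewrite sum_Sn. apply Rplus_le_le_0_compat; [exact IH | apply H].
Qed.

Lemma geom_bounded2_abs_summable (M rho : R) (u : nat -> nat -> C) :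
  (0 <= rho < 1)%R -> geom_bounded2 M rho u -> abs_summable2 u.
Proof.
  intros H Hu. exists (M / (1 - rho) / (1 - rho))%R. intros N1 N2.
  apply sum_n_geom_le; [exact H|]. intros n1; split.
  - apply sum_n_nonneg; intros; apply Cmod_ge_0.
  - replace (M / (1 - rho) * rho ^ n1)%R with (M * rho ^ n1 / (1 - rho))%R
      by (field; lra).
    apply sum_n_geom_le; [exact H|]. intros n2; split; [apply Cmod_ge_0 | apply Hu].
Qed.

(** * Termwise differentiation *)

(** The derivative of [t ^ n]; for [n = 0] the factor [INR n] annihilates the
    spurious power [t ^ pred 0 = 1]. *)
Definition dpow (t : C) (n : nat) : C := RtoC (INR n) * t ^ pred n.

Lemma dpow_S (t : C) (n : nat) : dpow t (S n) = t * dpow t n + t ^ n.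
Proof.
  unfold dpow. rewrite S_INR, RtoC_plus. destruct n as [|n]; simpl; ring.
Qed.

Lemma pow_increment_le (t h : C) (d : R) (n : nat) :
  (0 < d)%R -> (Cmod h <= d)%R ->
  (Cmod ((t + h) ^ n - t ^ n) <= Cmod h / d * (Cmod t + d) ^ n)%R.
Proof.
  intros Hd Hh. pose proof (Cmod_ge_0 t) as Ht. pose proof (Cmod_ge_0 h) as Hh0.
  assert (Hq : (0 <= Cmod h / d)%R) by (apply Rdiv_le_0_compat; lra).
  induction n as [|n IH].
  - simpl. replace (1 - 1) with (RtoC 0) by ring. rewrite Cmod_0. lra.
  - replace ((t + h) ^ S n - t ^ S n)
      with (t * ((t + h) ^ n - t ^ n) + h * (t + h) ^ n) by (simpl; ring).
    eapply Rle_trans. { apply Cmod_triangle. }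
    rewrite !Cmod_mult, Cmod_pow.
    assert (Hp : (Cmod (t + h) ^ n <= (Cmod t + d) ^ n)%R).
    { apply pow_incr. split; [apply Cmod_ge_0|].
      eapply Rle_trans; [apply Cmod_triangle|lra]. }
    replace (Cmod h / d * (Cmod t + d) ^ S n)%R
      with (Cmod t * (Cmod h / d * (Cmod t + d) ^ n) + Cmod h * (Cmod t + d) ^ n)%R
      by (simpl; field; lra).
    apply Rplus_le_compat; apply Rmult_le_compat_l; assumption.
Qed.

(** The remainder is the part of degree at least two in [h] of the binomial
    expansion, and each [(|h| / d) ^ k] with [k >= 2] is at most the square.  The
    induction reaches the same bound without expanding: the remainder of order
    [n + 1] is [t] times the remainder of order [n] plus [h] times the increment of
    [t ^ n]. *)
Lemma pow_taylor_remainder_le (t h : C) (d : R) (n : nat) :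
  (0 < d)%R -> (Cmod h <= d)%R ->
  (Cmod ((t + h) ^ n - t ^ n - h * dpow t n) <= (Cmod h / d) ^ 2 * (Cmod t + d) ^ n)%R.
Proof.
  intros Hd Hh. pose proof (Cmod_ge_0 t) as Ht. pose proof (Cmod_ge_0 h) as Hh0.
  assert (Hq : (0 <= Cmod h / d)%R) by (apply Rdiv_le_0_compat; lra).
  induction n as [|n IH].
  - unfold dpow. replace ((t + h) ^ 0 - t ^ 0 - _) with (RtoC 0) by (simpl; ring).
    rewrite Cmod_0. simpl. nra.
  - replace ((t + h) ^ S n - t ^ S n - h * dpow t (S n))
      with (t * ((t + h) ^ n - t ^ n - h * dpow t n) + h * ((t + h) ^ n - t ^ n))
      by (rewrite dpow_S; simpl; ring).
    eapply Rle_trans. { apply Cmod_triangle. }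
    rewrite !Cmod_mult.
    replace ((Cmod h / d) ^ 2 * (Cmod t + d) ^ S n)%R
      with (Cmod t * ((Cmod h / d) ^ 2 * (Cmod t + d) ^ n)
            + Cmod h * (Cmod h / d * (Cmod t + d) ^ n))%R
      by (simpl; field; lra).
    apply Rplus_le_compat; apply Rmult_le_compat_l; try assumption.
    now apply pow_increment_le.
Qed.

Lemma Cmod_dpow_le (t : C) (d : R) (n : nat) :
  (0 < d)%R -> (Cmod (dpow t n) <= / d * (Cmod t + d) ^ n)%R.
Proof.
  intros Hd. pose proof (Cmod_ge_0 t) as Ht.
  pose proof (Rinv_0_lt_compat d Hd) as Hi.
  induction n as [|n IH].
  - unfold dpow; simpl. replace (0 * 1) with (RtoC 0) by ring. rewrite Cmod_0. lra.
  - rewrite dpow_S. eapply Rle_trans. { apply Cmod_triangle. }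
    rewrite !Cmod_mult, Cmod_pow.
    replace (/ d * (Cmod t + d) ^ S n)%R
      with (Cmod t * (/ d * (Cmod t + d) ^ n) + (Cmod t + d) ^ n)%R
      by (simpl; field; lra).
    apply Rplus_le_compat.
    + now apply Rmult_le_compat_l.
    + apply pow_incr. lra.
Qed.

(** Reduces complex differentiability to an estimate that can be summed over the
    terms of a series. *)
Lemma is_derive_of_quadratic_remainder (g : C -> C) (t l : C) (K d : R) :
  (0 < d)%R ->
  (forall h : C, (Cmod h <= d)%R -> (Cmod (g (t + h)%C - g t - h * l) <= K * Cmod h ^ 2)%R) ->
  is_derive g t l.
Proof.
  intros Hd Hg. split. { apply (is_linear_scal_l (K := C_AbsRing) (V := C_NormedModule) l). }
  intros x Hx.
  apply (is_filter_lim_locally_unique (K := C_AbsRing) (V := AbsRing_NormedModule C_AbsRing)) in Hx.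
  subst x. intros eps.
  pose proof (cond_pos eps) as He.
  assert (HK : (0 < Rabs K + 1)%R) by (pose proof (Rabs_pos K); lra).
  assert (Hr : (0 < Rmin d (eps / (Rabs K + 1)))%R).
  { apply Rmin_glb_lt; [exact Hd|]. now apply Rdiv_lt_0_compat. }
  exists (mkposreal _ Hr). intros y Hy.
  change (Cmod (y - t) < Rmin d (eps / (Rabs K + 1)))%R in Hy.
  change (Cmod (g y - g t - (y - t) * l) <= eps * Cmod (y - t))%R.
  pose proof (Rmin_l d (eps / (Rabs K + 1))).
  pose proof (Rmin_r d (eps / (Rabs K + 1))).
  pose proof (Hg (y - t) ltac:(lra)) as Hb.
  assert (Hadd : forall a b : C, a + (b - a) = b) by (intros; ring).
  rewrite Hadd in Hb.
  eapply Rle_trans. { exact Hb. }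
  pose proof (Cmod_ge_0 (y - t)) as Hn.
  replace (K * Cmod (y - t) ^ 2)%R with ((K * Cmod (y - t)) * Cmod (y - t))%R by ring.
  apply Rmult_le_compat_r; [exact Hn|].
  apply Rle_trans with ((Rabs K + 1) * (eps / (Rabs K + 1)))%R.
  - pose proof (Rle_abs K). apply Rle_trans with ((Rabs K + 1) * Cmod (y - t))%R; nra.
  - apply Req_le. field. lra.
Qed.

(** Convergence at the enlarged radius [Cmod t + d] dominates, through
    [pow_taylor_remainder_le], the remainders of all terms at once by
    [(Cmod h / d) ^ 2].  The exponent [k] is an arbitrary function of the two
    indices so that both variables are covered. *)
Lemma is_derive_C_Series2 (w : nat -> nat -> C) (k : nat -> nat -> nat)
    (t : C) (d M rho : R) :
  (0 < d)%R -> (0 <= rho < 1)%R ->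
  (forall n1 n2,
     (Cmod (w n1 n2) * (Cmod t + d) ^ k n1 n2 <= M * rho ^ n1 * rho ^ n2)%R) ->
  is_derive (fun z => C_Series2 (fun n1 n2 => w n1 n2 * z ^ k n1 n2)) t
    (C_Series2 (fun n1 n2 => w n1 n2 * dpow t (k n1 n2))).
Proof.
  intros Hd Hr Hw.
  apply is_derive_of_quadratic_remainder with (K := ((2 / (1 - rho)) ^ 2 * (M / d ^ 2))%R) (d := d);
    [exact Hd|].
  intros h Hh. pose proof (Cmod_ge_0 h) as Hh0.
  assert (Hpow : forall z, (Cmod z <= Cmod t + d)%R ->
            geom_bounded2 M rho (fun n1 n2 => w n1 n2 * z ^ k n1 n2)).
  { intros z Hz n1 n2. eapply Rle_trans; [|apply Hw]. rewrite Cmod_mult, Cmod_pow.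
    apply Rmult_le_compat_l; [apply Cmod_ge_0|]. apply pow_incr.
    split; [apply Cmod_ge_0 | exact Hz]. }
  assert (H1 := Hpow (t + h) ltac:(eapply Rle_trans; [apply Cmod_triangle|lra])).
  assert (H2 := Hpow t ltac:(lra)).
  assert (H3 : geom_bounded2 (/ d * M) rho (fun n1 n2 => w n1 n2 * dpow t (k n1 n2))).
  { intros n1 n2. rewrite Cmod_mult.
    replace (/ d * M * rho ^ n1 * rho ^ n2)%R with (/ d * (M * rho ^ n1 * rho ^ n2))%R by ring.
    apply Rle_trans with (/ d * (Cmod (w n1 n2) * (Cmod t + d) ^ k n1 n2))%R.
    - replace (/ d * (Cmod (w n1 n2) * (Cmod t + d) ^ k n1 n2))%R
        with (Cmod (w n1 n2) * (/ d * (Cmod t + d) ^ k n1 n2))%R by ring.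
      apply Rmult_le_compat_l; [apply Cmod_ge_0|]. now apply Cmod_dpow_le.
    - apply Rmult_le_compat_l; [left; now apply Rinv_0_lt_compat | apply Hw]. }
  (* The difference is written as a sum of scaled series to use linearity. *)
  assert (H2' : geom_bounded2 M rho (fun n1 n2 => -1 * (w n1 n2 * t ^ k n1 n2))).
  { intros n1 n2. rewrite Cmod_mult. replace (Cmod (-1)) with 1%R.
    2: { rewrite Cmod_R, Rabs_left; lra. }
    rewrite Rmult_1_l. apply H2. }
  assert (H3' : geom_bounded2 (Cmod h * (/ d * M)) rho
                  (fun n1 n2 => - h * (w n1 n2 * dpow t (k n1 n2)))).
  { intros n1 n2. rewrite Cmod_mult, Cmod_opp.
    replace (Cmod h * (/ d * M) * rho ^ n1 * rho ^ n2)%R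
      with (Cmod h * (/ d * M * rho ^ n1 * rho ^ n2))%R by ring.
    apply Rmult_le_compat_l; [exact Hh0 | apply H3]. }
  replace (C_Series2 (fun n1 n2 => w n1 n2 * (t + h) ^ k n1 n2)
           - C_Series2 (fun n1 n2 => w n1 n2 * t ^ k n1 n2)
           - h * C_Series2 (fun n1 n2 => w n1 n2 * dpow t (k n1 n2)))
    with (C_Series2 (fun n1 n2 => w n1 n2 * (t + h) ^ k n1 n2)
          + (C_Series2 (fun n1 n2 => -1 * (w n1 n2 * t ^ k n1 n2))
             + C_Series2 (fun n1 n2 => - h * (w n1 n2 * dpow t (k n1 n2))))).
  2: { rewrite (C_Series2_scal _ _ _ _ Hr H2), (C_Series2_scal _ _ _ _ Hr H3). ring. }
  rewrite <- (C_Series2_plus _ _ _ _ _ _ Hr H2' Hr H3').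
  rewrite <- (C_Series2_plus M rho (M + Cmod h * (/ d * M)) rho _ _ Hr H1 Hr).
  2: { intros n1 n2. rewrite !Rmult_plus_distr_r.
       eapply Rle_trans; [apply Cmod_triangle|].
       apply Rplus_le_compat; [apply H2' | apply H3']. }
  eapply Rle_trans.
  { apply Cmod_C_Series2_le with (M := ((Cmod h / d) ^ 2 * M)%R) (rho := rho); [exact Hr|].
    intros n1 n2.
    replace (w n1 n2 * (t + h) ^ k n1 n2 +
       (-1 * (w n1 n2 * t ^ k n1 n2) + - h * (w n1 n2 * dpow t (k n1 n2))))
      with (w n1 n2 * ((t + h) ^ k n1 n2 - t ^ k n1 n2 - h * dpow t (k n1 n2))) by ring.
    rewrite Cmod_mult.
    apply Rle_trans with (Cmod (w n1 n2) * ((Cmod h / d) ^ 2 * (Cmod t + d) ^ k n1 n2))%R.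
    - apply Rmult_le_compat_l; [apply Cmod_ge_0|]. now apply pow_taylor_remainder_le.
    - replace (Cmod (w n1 n2) * ((Cmod h / d) ^ 2 * (Cmod t + d) ^ k n1 n2))%R
        with ((Cmod h / d) ^ 2 * (Cmod (w n1 n2) * (Cmod t + d) ^ k n1 n2))%R by ring.
      rewrite !Rmult_assoc, <- (Rmult_assoc M).
      apply Rmult_le_compat_l; [apply pow2_ge_0 | apply Hw]. }
  apply Req_le. field. lra.
Qed.

(** * Double power series and their convergence *)

Definition power_term (c : nat -> nat -> C) (x1 x2 : C) (n1 n2 : nat) : C :=
  c n1 n2 * x1 ^ n1 * x2 ^ n2.

Definition power_series2 (c : nat -> nat -> C) (x1 x2 : C) : C := C_Series2 (power_term c x1 x2).

(** The margin [d] leaves room for the polynomial factors produced by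
    differentiation, and [rho < 1] for summing. *)
Definition converges_on (D : C -> C -> Prop) (c : nat -> nat -> C) : Prop :=
  forall x1 x2, D x1 x2 ->
  exists d M rho : R, (0 < d)%R /\ (0 < rho < 1)%R /\
  forall n1 n2,
    (Cmod (c n1 n2) * (Cmod x1 + d) ^ n1 * (Cmod x2 + d) ^ n2
       <= M * rho ^ n1 * rho ^ n2)%R.

Definition represents (D : C -> C -> Prop) (f : C -> C -> C) (c : nat -> nat -> C) : Prop :=
  converges_on D c /\ forall x1 x2, D x1 x2 -> f x1 x2 = power_series2 c x1 x2.

(** Partial derivatives only see the two coordinate lines through a point, so
    this weak form of openness is enough to differentiate an identity that holds
    on [D]. *)
Definition slice_open (D : C -> C -> Prop) : Prop :=
  forall x1 x2, D x1 x2 -> exists e : R, (0 < e)%R /\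
    forall y, ((Cmod (y - x1) < e)%R -> D y x2) /\ ((Cmod (y - x2) < e)%R -> D x1 y).

Lemma pow_Cmod_le (x : C) (d : R) (n : nat) :
  (0 <= d)%R -> (0 <= Cmod x ^ n <= (Cmod x + d) ^ n)%R.
Proof.
  intros Hd. pose proof (Cmod_ge_0 x). split; [now apply pow_le|].
  apply pow_incr. lra.
Qed.

Lemma power_term_geom_bounded (c : nat -> nat -> C) (x1 x2 : C) (d M rho : R) :
  (0 < d)%R ->
  (forall n1 n2, (Cmod (c n1 n2) * (Cmod x1 + d) ^ n1 * (Cmod x2 + d) ^ n2
       <= M * rho ^ n1 * rho ^ n2)%R) ->
  geom_bounded2 M rho (power_term c x1 x2).
Proof.
  intros Hd Hc n1 n2. eapply Rle_trans; [|apply Hc].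
  unfold power_term. rewrite !Cmod_mult, !Cmod_pow.
  destruct (pow_Cmod_le x1 d n1 ltac:(lra)) as [? ?].
  destruct (pow_Cmod_le x2 d n2 ltac:(lra)) as [? ?].
  pose proof (Cmod_ge_0 (c n1 n2)).
  apply Rmult_le_compat; try assumption; [now apply Rmult_le_pos|].
  now apply Rmult_le_compat_l.
Qed.

Lemma converges_on_geom_bounded (D : C -> C -> Prop) (c : nat -> nat -> C) (x1 x2 : C) :
  converges_on D c -> D x1 x2 ->
  exists M rho, (0 <= rho < 1)%R /\ geom_bounded2 M rho (power_term c x1 x2).
Proof.
  intros Hc Hx. destruct (Hc x1 x2 Hx) as (d & M & rho & Hd & Hr & H).
  exists M, rho. split; [lra|]. exact (power_term_geom_bounded c x1 x2 d M rho Hd H).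
Qed.

Lemma converges_on_ext (D : C -> C -> Prop) (c e : nat -> nat -> C) :
  (forall n1 n2, c n1 n2 = e n1 n2) -> converges_on D c -> converges_on D e.
Proof.
  intros He Hc x1 x2 Hx. destruct (Hc x1 x2 Hx) as (d & M & rho & Hd & Hr & H).
  exists d, M, rho. repeat split; try tauto. intros n1 n2. rewrite <- He. apply H.
Qed.

Lemma power_series2_ext (c e : nat -> nat -> C) (x1 x2 : C) :
  (forall n1 n2, c n1 n2 = e n1 n2) -> power_series2 c x1 x2 = power_series2 e x1 x2.
Proof. intros H. apply C_Series2_ext. intros. unfold power_term. now rewrite H. Qed.

Lemma represents_ext (D : C -> C -> Prop) (f : C -> C -> C) (c e : nat -> nat -> C) :
  (forall n1 n2, c n1 n2 = e n1 n2) -> represents D f c -> represents D f e.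
Proof.
  intros He [Hc Hf]. split; [exact (converges_on_ext D c e He Hc)|].
  intros x1 x2 Hx. rewrite (Hf x1 x2 Hx). now apply power_series2_ext.
Qed.

(** Transfers convergence statements from the first index to the second. *)
Definition transpose {A B : Type} (c : A -> A -> B) : A -> A -> B := fun x y => c y x.

Lemma converges_on_transpose (D : C -> C -> Prop) (c : nat -> nat -> C) :
  converges_on D c -> converges_on (transpose D) (transpose c).
Proof.
  intros Hc x1 x2 Hx. destruct (Hc x2 x1 Hx) as (d & M & rho & Hd & Hr & H).
  exists d, M, rho. repeat split; try tauto. intros n1 n2.
  unfold transpose. specialize (H n2 n1). lra.
Qed.

(** Coefficients of the partial derivatives ([diff1], [diff2]) and of the products
    with a variable ([shift1], [shift2]). *)
Definition diff1 (c : nat -> nat -> C) (n1 n2 : nat) : C :=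
  RtoC (INR (S n1)) * c (S n1) n2.
Definition diff2 (c : nat -> nat -> C) (n1 n2 : nat) : C :=
  RtoC (INR (S n2)) * c n1 (S n2).
Definition shift1 (c : nat -> nat -> C) (n1 n2 : nat) : C :=
  match n1 with O => 0 | S m1 => c m1 n2 end.
Definition shift2 (c : nat -> nat -> C) (n1 n2 : nat) : C :=
  match n2 with O => 0 | S m2 => c n1 m2 end.

(** Half of the margin pays for the factor [n1 + 1]: by [Cmod_dpow_le],
    [(n + 1) r ^ n] is at most [(r + d / 2) ^ (n + 1)] divided by [d / 2]. *)
Lemma converges_on_diff1 (D : C -> C -> Prop) (c : nat -> nat -> C) :
  converges_on D c -> converges_on D (diff1 c).
Proof.
  intros Hc x1 x2 Hx. destruct (Hc x1 x2 Hx) as (d & M & rho & Hd & Hr & H).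
  exists (d / 2)%R, (2 / d * (M * rho))%R, rho. repeat split; try lra.
  intros n1 n2. pose proof (Cmod_ge_0 x1) as H1. pose proof (Cmod_ge_0 x2) as H2.
  pose proof (Cmod_dpow_le (RtoC (Cmod x1 + d / 2)) (d / 2) (S n1) ltac:(lra)) as Hp.
  unfold dpow in Hp. rewrite Cmod_mult, Cmod_pow, !Cmod_R in Hp.
  rewrite (Rabs_pos_eq (Cmod x1 + d / 2)) in Hp by lra.
  replace (Cmod x1 + d / 2 + d / 2)%R with (Cmod x1 + d)%R in Hp by field.
  unfold diff1. rewrite Cmod_mult, Cmod_R. simpl pred in Hp.
  assert (Hq : (0 <= (Cmod x2 + d / 2) ^ n2 <= (Cmod x2 + d) ^ n2)%R).
  { split; [apply pow_le; lra | apply pow_incr; lra]. }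
  assert (Hi : (0 < / (d / 2))%R) by (apply Rinv_0_lt_compat; lra).
  pose proof (Cmod_ge_0 (c (S n1) n2)) as Hc0.
  pose proof (Rabs_pos (INR (S n1))) as HI.
  pose proof (pow_le (Cmod x1 + d / 2) n1 ltac:(lra)) as Hp0.
  apply Rle_trans with
    (Cmod (c (S n1) n2) * (/ (d / 2) * (Cmod x1 + d) ^ S n1) * (Cmod x2 + d) ^ n2)%R.
  - apply Rmult_le_compat; try tauto.
    + repeat apply Rmult_le_pos; assumption.
    + replace (Rabs (INR (S n1)) * Cmod (c (S n1) n2) * (Cmod x1 + d / 2) ^ n1)%R
        with (Cmod (c (S n1) n2) * (Rabs (INR (S n1)) * (Cmod x1 + d / 2) ^ n1))%R by ring.
      now apply Rmult_le_compat_l.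
  - specialize (H (S n1) n2).
    apply (Rmult_le_compat_l (/ (d / 2))) in H; [|lra].
    eapply Rle_trans; [|eapply Rle_trans; [exact H|]]; apply Req_le.
    + ring.
    + simpl. field. lra.
Qed.

Lemma converges_on_diff2 (D : C -> C -> Prop) (c : nat -> nat -> C) :
  converges_on D c -> converges_on D (diff2 c).
Proof.
  intros Hc.
  exact (converges_on_transpose _ _ (converges_on_diff1 _ _ (converges_on_transpose _ _ Hc))).
Qed.

Lemma converges_on_shift1 (D : C -> C -> Prop) (c : nat -> nat -> C) :
  converges_on D c -> converges_on D (shift1 c).
Proof.
  intros Hc x1 x2 Hx. destruct (Hc x1 x2 Hx) as (d & M & rho & Hd & Hr & H).
  exists d, ((Cmod x1 + d) / rho * M)%R, rho. repeat split; try lra.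
  intros n1 n2. pose proof (Cmod_ge_0 x1) as H1.
  assert (HM : (0 <= M)%R).
  { specialize (H O O). simpl in H. pose proof (Cmod_ge_0 (c O O)). lra. }
  assert (Hq : (0 <= (Cmod x1 + d) / rho)%R) by (apply Rdiv_le_0_compat; lra).
  destruct n1 as [|n1]; simpl shift1.
  - rewrite Cmod_0, !Rmult_0_l.
    apply Rmult_le_pos; [|apply pow_le; lra].
    apply Rmult_le_pos; [now apply Rmult_le_pos | apply pow_le; lra].
  - specialize (H n1 n2). apply (Rmult_le_compat_l (Cmod x1 + d)) in H; [|lra].
    eapply Rle_trans; [|eapply Rle_trans; [exact H|]]; apply Req_le; simpl.
    + ring.
    + field. lra.
Qed.

Lemma converges_on_shift2 (D : C -> C -> Prop) (c : nat -> nat -> C) :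
  converges_on D c -> converges_on D (shift2 c).
Proof.
  intros Hc.
  exact (converges_on_transpose _ _ (converges_on_shift1 _ _ (converges_on_transpose _ _ Hc))).
Qed.

Lemma converges_on_scal (D : C -> C -> Prop) (a : C) (c : nat -> nat -> C) :
  converges_on D c -> converges_on D (fun n1 n2 => a * c n1 n2).
Proof.
  intros Hc x1 x2 Hx. destruct (Hc x1 x2 Hx) as (d & M & rho & Hd & Hr & H).
  exists d, (Cmod a * M)%R, rho. repeat split; try lra.
  intros n1 n2. specialize (H n1 n2).
  apply (Rmult_le_compat_l (Cmod a)) in H; [|apply Cmod_ge_0].
  rewrite Cmod_mult. lra.
Qed.

Lemma converges_on_add (D : C -> C -> Prop) (c e : nat -> nat -> C) :
  converges_on D c -> converges_on D e ->
  converges_on D (fun n1 n2 => c n1 n2 + e n1 n2).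
Proof.
  intros Hc He x1 x2 Hx.
  destruct (Hc x1 x2 Hx) as (d & M & rho & Hd & Hr & H).
  destruct (He x1 x2 Hx) as (d' & M' & rho' & Hd' & Hr' & H').
  pose proof (Cmod_ge_0 x1) as H1. pose proof (Cmod_ge_0 x2) as H2.
  (* Both bounds are brought to the smaller margin and the larger rate. *)
  assert (weaken : forall (u : nat -> nat -> C) (t N s : R),
    (Rmin d d' <= t)%R -> (0 <= s <= Rmax rho rho')%R ->
    (forall n1 n2, (Cmod (u n1 n2) * (Cmod x1 + t) ^ n1 * (Cmod x2 + t) ^ n2
       <= N * s ^ n1 * s ^ n2)%R) ->
    (forall n1 n2, (Cmod (u n1 n2) * (Cmod x1 + Rmin d d') ^ n1 * (Cmod x2 + Rmin d d') ^ n2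
       <= N * Rmax rho rho' ^ n1 * Rmax rho rho' ^ n2)%R)).
  { intros u t N s Ht Hs Hu n1 n2.
    assert (HN : (0 <= N)%R).
    { specialize (Hu O O). simpl in Hu. pose proof (Cmod_ge_0 (u O O)). lra. }
    assert (Hm : (0 < Rmin d d')%R) by now apply Rmin_glb_lt.
    eapply Rle_trans; [|eapply Rle_trans; [apply Hu|]].
    - repeat apply Rmult_le_compat; try apply pow_incr; try apply Rmult_le_pos;
        try apply pow_le; try apply Cmod_ge_0; lra.
    - repeat apply Rmult_le_compat; try apply pow_incr; try apply Rmult_le_pos;
        try apply pow_le; lra. }
  exists (Rmin d d'), (M + M')%R, (Rmax rho rho').
  assert (Hmax := Rmax_l rho rho').
  split; [now apply Rmin_glb_lt|]. split.
  { split; [lra | apply Rmax_lub_lt; lra]. }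
  intros n1 n2.
  pose proof (weaken c d M rho (Rmin_l d d') ltac:(lra) H n1 n2) as W.
  pose proof (weaken e d' M' rho' (Rmin_r d d') ltac:(pose proof (Rmax_r rho rho'); lra) H' n1 n2) as W'.
  rewrite !Rmult_plus_distr_r.
  eapply Rle_trans; [|apply Rplus_le_compat; [exact W | exact W']].
  rewrite <- !Rmult_plus_distr_r.
  assert (Hm : (0 < Rmin d d')%R) by now apply Rmin_glb_lt.
  apply Rmult_le_compat_r; [apply pow_le; lra|].
  apply Rmult_le_compat_r; [apply pow_le; lra|].
  apply Cmod_triangle.
Qed.

(** * Operations on represented functions *)

Lemma represents_scal (D : C -> C -> Prop) (f : C -> C -> C) (a : C) (c : nat -> nat -> C) :
  represents D f c -> represents D (op_const a f) (fun n1 n2 => a * c n1 n2).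
Proof.
  intros [Hc Hf]. split; [now apply converges_on_scal|].
  intros x1 x2 Hx. unfold op_const. rewrite (Hf x1 x2 Hx). unfold power_series2.
  destruct (converges_on_geom_bounded D c x1 x2 Hc Hx) as (M & rho & Hr & H).
  rewrite <- (C_Series2_scal _ _ a _ Hr H).
  apply C_Series2_ext. intros. unfold power_term. ring.
Qed.

Lemma represents_add (D : C -> C -> Prop) (f g : C -> C -> C) (c e : nat -> nat -> C) :
  represents D f c -> represents D g e ->
  represents D (fun x1 x2 => f x1 x2 + g x1 x2) (fun n1 n2 => c n1 n2 + e n1 n2).
Proof.
  intros [Hc Hf] [He Hg]. split; [now apply converges_on_add|].
  intros x1 x2 Hx. rewrite (Hf x1 x2 Hx), (Hg x1 x2 Hx). unfold power_series2.
  destruct (converges_on_geom_bounded D c x1 x2 Hc Hx) as (M & rho & Hr & H).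
  destruct (converges_on_geom_bounded D e x1 x2 He Hx) as (M' & rho' & Hr' & H').
  rewrite <- (C_Series2_plus _ _ _ _ _ _ Hr H Hr' H').
  apply C_Series2_ext. intros. unfold power_term. ring.
Qed.

Lemma represents_x1 (D : C -> C -> Prop) (f : C -> C -> C) (c : nat -> nat -> C) :
  represents D f c -> represents D (op_x1 f) (shift1 c).
Proof.
  intros [Hc Hf]. split; [now apply converges_on_shift1|].
  intros x1 x2 Hx. unfold op_x1. rewrite (Hf x1 x2 Hx). unfold power_series2.
  destruct (converges_on_geom_bounded D c x1 x2 Hc Hx) as (M & rho & Hr & H).
  rewrite <- (C_Series2_scal _ _ x1 _ Hr H).
  rewrite (C_Series2_shift1 (power_term (shift1 c) x1 x2)).
  - apply C_Series2_ext. intros. unfold power_term. simpl. ring.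
  - intros. unfold power_term. simpl. ring.
Qed.

Lemma represents_x2 (D : C -> C -> Prop) (f : C -> C -> C) (c : nat -> nat -> C) :
  represents D f c -> represents D (op_x2 f) (shift2 c).
Proof.
  intros [Hc Hf]. split; [now apply converges_on_shift2|].
  intros x1 x2 Hx. unfold op_x2. rewrite (Hf x1 x2 Hx). unfold power_series2.
  destruct (converges_on_geom_bounded D c x1 x2 Hc Hx) as (M & rho & Hr & H).
  rewrite <- (C_Series2_scal _ _ x2 _ Hr H).
  rewrite (C_Series2_shift2 (power_term (shift2 c) x1 x2)).
  - apply C_Series2_ext. intros. unfold power_term. simpl. ring.
  - intros. unfold power_term. simpl. ring.
Qed.

Lemma is_derive_power_series2_1 (D : C -> C -> Prop) (c : nat -> nat -> C) (x1 x2 : C) :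
  converges_on D c -> D x1 x2 ->
  is_derive (fun t : C => power_series2 c t x2) x1 (power_series2 (diff1 c) x1 x2).
Proof.
  intros Hc Hx. destruct (Hc x1 x2 Hx) as (d & M & rho & Hd & Hr & H).
  pose proof (is_derive_C_Series2 (fun n1 n2 => c n1 n2 * x2 ^ n2) (fun n1 _ => n1)
                x1 d M rho Hd ltac:(lra)) as Hder.
  replace (power_series2 (diff1 c) x1 x2)
    with (C_Series2 (fun n1 n2 => c n1 n2 * x2 ^ n2 * dpow x1 n1)).
  - apply is_derive_ext with
      (f := fun t : C => C_Series2 (fun n1 n2 => c n1 n2 * x2 ^ n2 * t ^ n1)).
    { intros t. apply C_Series2_ext. intros. unfold power_term. simpl. ring. }
    apply Hder. intros n1 n2. eapply Rle_trans; [|apply H].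
    rewrite Cmod_mult, Cmod_pow.
    replace (Cmod (c n1 n2) * (Cmod x1 + d) ^ n1 * (Cmod x2 + d) ^ n2)%R
      with (Cmod (c n1 n2) * (Cmod x2 + d) ^ n2 * (Cmod x1 + d) ^ n1)%R by ring.
    pose proof (Cmod_ge_0 x1).
    apply Rmult_le_compat_r; [apply pow_le; lra|].
    apply Rmult_le_compat_l; [apply Cmod_ge_0|]. apply pow_Cmod_le; lra.
  - unfold power_series2. rewrite C_Series2_shift1.
    + apply C_Series2_ext. intros. unfold power_term, diff1, dpow. simpl pred. ring.
    + intros. unfold dpow. simpl. ring.
Qed.

Lemma is_derive_power_series2_2 (D : C -> C -> Prop) (c : nat -> nat -> C) (x1 x2 : C) :
  converges_on D c -> D x1 x2 ->
  is_derive (fun t : C => power_series2 c x1 t) x2 (power_series2 (diff2 c) x1 x2).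
Proof.
  intros Hc Hx. destruct (Hc x1 x2 Hx) as (d & M & rho & Hd & Hr & H).
  pose proof (is_derive_C_Series2 (fun n1 n2 => c n1 n2 * x1 ^ n1) (fun _ n2 => n2)
                x2 d M rho Hd ltac:(lra)) as Hder.
  replace (power_series2 (diff2 c) x1 x2)
    with (C_Series2 (fun n1 n2 => c n1 n2 * x1 ^ n1 * dpow x2 n2)).
  - apply Hder. intros n1 n2. eapply Rle_trans; [|apply H].
    rewrite Cmod_mult, Cmod_pow.
    pose proof (Cmod_ge_0 x2).
    apply Rmult_le_compat_r; [apply pow_le; lra|].
    apply Rmult_le_compat_l; [apply Cmod_ge_0|]. apply pow_Cmod_le; lra.
  - unfold power_series2. rewrite C_Series2_shift2.
    + apply C_Series2_ext. intros. unfold power_term, diff2, dpow. simpl pred. ring.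
    + intros. unfold dpow. simpl. ring.
Qed.

Lemma represents_is_derive_1 (D : C -> C -> Prop) (f : C -> C -> C) (c : nat -> nat -> C)
    (x1 x2 : C) :
  slice_open D -> represents D f c -> D x1 x2 ->
  is_derive (fun t : C => f t x2) x1 (power_series2 (diff1 c) x1 x2).
Proof.
  intros HD [Hc Hf] Hx. destruct (HD x1 x2 Hx) as (e & He & Hopen).
  apply is_derive_ext_loc with (f := fun t : C => power_series2 c t x2).
  - exists (mkposreal e He). intros y Hy. symmetry. apply Hf, Hopen, Hy.
  - exact (is_derive_power_series2_1 D c x1 x2 Hc Hx).
Qed.

Lemma represents_is_derive_2 (D : C -> C -> Prop) (f : C -> C -> C) (c : nat -> nat -> C)
    (x1 x2 : C) :
  slice_open D -> represents D f c -> D x1 x2 ->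
  is_derive (fun t : C => f x1 t) x2 (power_series2 (diff2 c) x1 x2).
Proof.
  intros HD [Hc Hf] Hx. destruct (HD x1 x2 Hx) as (e & He & Hopen).
  apply is_derive_ext_loc with (f := fun t : C => power_series2 c x1 t).
  - exists (mkposreal e He). intros y Hy. symmetry. apply Hf, Hopen, Hy.
  - exact (is_derive_power_series2_2 D c x1 x2 Hc Hx).
Qed.

Lemma represents_partial1 (D : C -> C -> Prop) (f : C -> C -> C) (c : nat -> nat -> C) :
  slice_open D -> represents D f c -> represents D (partial1 f) (diff1 c).
Proof.
  intros HD Hf. split; [apply converges_on_diff1, Hf|].
  intros x1 x2 Hx. apply is_C_derive_unique.
  exact (represents_is_derive_1 D f c x1 x2 HD Hf Hx).
Qed.

Lemma represents_partial2 (D : C -> C -> Prop) (f : C -> C -> C) (c : nat -> nat -> C) :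
  slice_open D -> represents D f c -> represents D (partial2 f) (diff2 c).
Proof.
  intros HD Hf. split; [apply converges_on_diff2, Hf|].
  intros x1 x2 Hx. apply is_C_derive_unique.
  exact (represents_is_derive_2 D f c x1 x2 HD Hf Hx).
Qed.

(** Every order is reached at once because [represents] is inherited by partial
    derivatives. *)
Lemma represents_derivable_upto (D : C -> C -> Prop) (k : nat) :
  slice_open D -> forall f c, represents D f c -> C_derivable_upto k D f.
Proof.
  intros HD. induction k as [|k IH]; intros f c Hf; [exact I|].
  split; [|split].
  - intros x1 x2 Hx. split.
    + eexists. exact (represents_is_derive_1 D f c x1 x2 HD Hf Hx).
    + eexists. exact (represents_is_derive_2 D f c x1 x2 HD Hf Hx).
  - exact (IH _ _ (represents_partial1 D f c HD Hf)).
  - exact (IH _ _ (represents_partial2 D f c HD Hf)).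
Qed.

(** * Operators acting diagonally on coefficients *)

(** Polynomials in [theta1] and [theta2] multiply the coefficient of index
    [(n1, n2)] by their value [m n1 n2] at that index. *)
Definition has_symbol (D : C -> C -> Prop) (T : Op) (m : nat -> nat -> C) : Prop :=
  forall f c, represents D f c -> represents D (T f) (fun n1 n2 => m n1 n2 * c n1 n2).

Lemma has_symbol_const (D : C -> C -> Prop) (a : C) :
  has_symbol D (op_const a) (fun _ _ => a).
Proof. intros f c Hf. now apply represents_scal. Qed.

Lemma has_symbol_add (D : C -> C -> Prop) (S T : Op) (m p : nat -> nat -> C) :
  has_symbol D S m -> has_symbol D T p ->
  has_symbol D (op_add S T) (fun n1 n2 => m n1 n2 + p n1 n2).
Proof.
  intros HS HT f c Hf.
  apply represents_ext with (2 := represents_add _ _ _ _ _ (HS f c Hf) (HT f c Hf)).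
  intros. ring.
Qed.

Lemma has_symbol_theta1 (D : C -> C -> Prop) :
  slice_open D -> has_symbol D theta1 (fun n1 _ => RtoC (INR n1)).
Proof.
  intros HD f c Hf.
  apply represents_ext with (2 := represents_x1 _ _ _ (represents_partial1 _ _ _ HD Hf)).
  intros [|n1] n2; [simpl; ring | reflexivity].
Qed.

Lemma has_symbol_theta2 (D : C -> C -> Prop) :
  slice_open D -> has_symbol D theta2 (fun _ n2 => RtoC (INR n2)).
Proof.
  intros HD f c Hf.
  apply represents_ext with (2 := represents_x2 _ _ _ (represents_partial2 _ _ _ HD Hf)).
  intros n1 [|n2]; [simpl; ring | reflexivity].
Qed.

Definition shifted_prod (l : list C) (z : C) : C := fold_right (fun b p => (b + z) * p) 1 l.

Lemma has_symbol_prod (D : C -> C -> Prop) (T : C -> Op) (m : nat -> nat -> C) (l : list C) :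
  (forall b, has_symbol D (T b) (fun n1 n2 => b + m n1 n2)) ->
  has_symbol D (op_prod (map T l)) (fun n1 n2 => shifted_prod l (m n1 n2)).
Proof.
  intros HT. induction l as [|b l IH]; intros f c Hf.
  - apply represents_ext with (2 := Hf). intros. simpl. ring.
  - apply represents_ext with (2 := HT b _ _ (IH f c Hf)). intros. simpl. ring.
Qed.

(** * The recurrence of the hypergeometric coefficients *)

Definition hypergeom_coeff (a B1 B2 : list C) (n1 n2 : nat) : C :=
  poch_prod a (n1 + n2) / (poch_prod B1 n1 * poch_prod B2 n2).

Lemma non_pole_shift (b : C) (n : nat) : non_pole b -> b + RtoC (INR n) <> 0.
Proof.
  intros Hb H. apply (Hb n). rewrite RtoC_opp.
  replace b with (b + RtoC (INR n) - RtoC (INR n)) by ring. rewrite H. ring.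
Qed.

Lemma non_pole_1 : non_pole 1.
Proof.
  intros k H. apply RtoC_inj in H. pose proof (pos_INR k). lra.
Qed.

Lemma poch_nonzero (b : C) (n : nat) : non_pole b -> poch b n <> 0.
Proof.
  intros Hb. induction n as [|n IH]; simpl.
  - apply C1_nz.
  - apply Cmult_neq_0; [exact IH | now apply non_pole_shift].
Qed.

Lemma poch_prod_nonzero (B : list C) (n : nat) :
  List.Forall non_pole B -> poch_prod B n <> 0.
Proof.
  intros HB. induction HB as [|b B Hb HB IH]; simpl.
  - apply C1_nz.
  - apply Cmult_neq_0; [now apply poch_nonzero | exact IH].
Qed.

Lemma shifted_prod_nonzero (B : list C) (n : nat) :
  List.Forall non_pole B -> shifted_prod B (RtoC (INR n)) <> 0.
Proof.
  intros HB. induction HB as [|b B Hb HB IH]; simpl.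
  - apply C1_nz.
  - apply Cmult_neq_0; [now apply non_pole_shift | exact IH].
Qed.

Lemma shifted_prod_root (B : list C) (b : C) : In b B -> shifted_prod B (- b) = 0.
Proof.
  induction B as [|b' B IH]; simpl; [tauto|]. intros [<-|H].
  - ring.
  - rewrite (IH H). ring.
Qed.

Lemma poch_prod_S (l : list C) (n : nat) :
  poch_prod l (S n) = poch_prod l n * shifted_prod l (RtoC (INR n)).
Proof.
  unfold poch_prod, shifted_prod.
  induction l as [|b l IH]; simpl in *; [ring|]. rewrite IH. ring.
Qed.

Lemma hypergeom_coeff_recurrence (a B1 B2 : list C) (n1 n2 : nat) :
  List.Forall non_pole B1 -> List.Forall non_pole B2 ->
  shifted_prod B1 (RtoC (INR n1)) * hypergeom_coeff a B1 B2 (S n1) n2 =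
  shifted_prod a (RtoC (INR n1) + RtoC (INR n2)) * hypergeom_coeff a B1 B2 n1 n2.
Proof.
  intros H1 H2. unfold hypergeom_coeff. simpl Nat.add.
  rewrite !poch_prod_S, plus_INR, RtoC_plus. field.
  repeat split; [now apply poch_prod_nonzero .. | now apply shifted_prod_nonzero].
Qed.

Lemma hypergeom_coeff_transpose (a B1 B2 : list C) (n1 n2 : nat) :
  hypergeom_coeff a B1 B2 n1 n2 = hypergeom_coeff a B2 B1 n2 n1.
Proof.
  unfold hypergeom_coeff. rewrite Nat.add_comm. f_equal. ring.
Qed.

(** The left symbol is [shifted_prod] at [n1 - 1], so that it meets the recurrence
    for the passage from [n1 - 1] to [n1]; at [n1 = 0] its argument is [-1], a root
    because [1] is an entry of [B1]. *)
Lemma hypergeom_coeff_balance (a B1 B2 : list C) (n1 n2 : nat) :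
  List.Forall non_pole B1 -> List.Forall non_pole B2 -> In (RtoC 1) B1 ->
  shifted_prod B1 (RtoC (INR n1) - 1) * hypergeom_coeff a B1 B2 n1 n2 =
  shift1 (fun m1 m2 => shifted_prod a (RtoC (INR m1) + RtoC (INR m2))
                       * hypergeom_coeff a B1 B2 m1 m2) n1 n2.
Proof.
  intros H1 H2 Hin. destruct n1 as [|n1].
  - simpl. replace (RtoC 0 - 1) with (- RtoC 1) by ring.
    rewrite (shifted_prod_root B1 (RtoC 1) Hin). ring.
  - rewrite S_INR, RtoC_plus.
    replace (RtoC (INR n1) + 1 - 1) with (RtoC (INR n1)) by ring.
    now apply hypergeom_coeff_recurrence.
Qed.

(** * Growth of the hypergeometric coefficients *)

(** A ratio test with an explicit geometric bound: the finitely many indices where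
    the ratio exceeds [q] only affect the constant. *)
Lemma ratio_geom_bounded (q : R) (N : nat) : (0 < q)%R ->
  forall r : nat -> R,
  (forall n, (N <= n)%nat -> (r (S n) <= q * r n)%R) ->
  exists K, forall n, (r n <= K * q ^ n)%R.
Proof.
  intros Hq. induction N as [|N IH]; intros r Hr.
  - exists (r O). intros n. induction n as [|n IHn]; simpl; [lra|].
    eapply Rle_trans; [apply Hr; lia|].
    apply (Rmult_le_compat_l q) in IHn; [|lra]. lra.
  - destruct (IH (fun n => r (S n))) as [K HK].
    { intros n Hn. apply Hr. lia. }
    exists (Rmax (r O) (K / q)). intros [|n].
    + simpl. rewrite Rmult_1_r. apply Rmax_l.
    + eapply Rle_trans; [apply HK|].
      apply Rle_trans with (K / q * q ^ S n)%R.
      * apply Req_le. simpl. field. lra.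
      * apply Rmult_le_compat_r; [apply pow_le; lra | apply Rmax_r].
Qed.

(** The quotient of consecutive ratios is [(a + n) / (b + n)], which tends to [1],
    so the ratio of the two symbols is eventually multiplied by at most [q] at each
    step. *)
Lemma poch_ratio_bound (a b : C) (q : R) : non_pole b -> (1 < q)%R ->
  exists K, forall n, (Cmod (poch a n) <= K * q ^ n * Cmod (poch b n))%R.
Proof.
  intros Hb Hq.
  (* Beyond this index [Cmod a + n <= q (n - Cmod b)]. *)
  destruct (INR_unbounded ((Cmod a + q * Cmod b) / (q - 1))) as [N HN].
  destruct (ratio_geom_bounded q N ltac:(lra)
              (fun n => Cmod (poch a n) / Cmod (poch b n))%R) as [K HK].
  - intros n Hn. simpl. rewrite !Cmod_mult.
    assert (Hpb : (0 < Cmod (poch b n))%R) by (apply Cmod_gt_0, poch_nonzero, Hb).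
    assert (Hbn : (0 < Cmod (b + RtoC (INR n)))%R) by (apply Cmod_gt_0, non_pole_shift, Hb).
    assert (Hfac : (Cmod (a + RtoC (INR n)) <= q * Cmod (b + RtoC (INR n)))%R).
    { apply le_INR in Hn. pose proof (pos_INR n).
      assert (HnN : ((Cmod a + q * Cmod b) <= INR n * (q - 1))%R).
      { apply Rle_div_l; lra. }
      pose proof (Cmod_triangle a (RtoC (INR n))) as T1.
      rewrite Cmod_R, Rabs_pos_eq in T1 by assumption.
      pose proof (Cmod_triangle (b + RtoC (INR n)) (- b)) as T2.
      rewrite Cmod_opp in T2.
      replace (b + RtoC (INR n) + - b) with (RtoC (INR n)) in T2 by ring.
      rewrite Cmod_R, Rabs_pos_eq in T2 by assumption.
      apply (Rmult_le_compat_l q) in T2; lra. }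
    apply Rle_div_l; [now apply Rmult_lt_0_compat|].
    apply Rle_trans with (Cmod (poch a n) * (q * Cmod (b + RtoC (INR n))))%R.
    + apply Rmult_le_compat_l; [apply Cmod_ge_0 | exact Hfac].
    + apply Req_le. field. lra.
  - exists K. intros n.
    assert (Hpb : (0 < Cmod (poch b n))%R) by (apply Cmod_gt_0, poch_nonzero, Hb).
    apply Rle_div_l; [exact Hpb | apply HK].
Qed.

Lemma poch_prod_ratio_bound (l1 : list C) : forall (l2 : list C) (q : R),
  length l1 = length l2 -> List.Forall non_pole l2 -> (1 < q)%R ->
  exists K, (0 <= K)%R /\
    forall n, (Cmod (poch_prod l1 n) <= K * q ^ n * Cmod (poch_prod l2 n))%R.
Proof.
  induction l1 as [|a l1 IH]; intros [|b l2] q Hlen H2 Hq; try discriminate.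
  - exists 1%R. split; [lra|]. intros n. simpl. rewrite Cmod_1.
    pose proof (pow_R1_Rle q n ltac:(lra)). lra.
  - inversion H2 as [|? ? Hb Hl2]; subst. injection Hlen as Hlen.
    (* The rate is split as [q = sqrt q * sqrt q] between the head and the tail. *)
    assert (Hs : (1 < sqrt q)%R). { rewrite <- sqrt_1. apply sqrt_lt_1; lra. }
    destruct (IH l2 (sqrt q) Hlen Hl2 Hs) as (K & HK0 & HK).
    destruct (poch_ratio_bound a b (sqrt q) Hb Hs) as (L & HL).
    assert (HL0 : (0 <= L)%R).
    { specialize (HL O). simpl in HL. rewrite Cmod_1 in HL. lra. }
    exists (L * K)%R. split; [now apply Rmult_le_pos|]. intros n. simpl.
    rewrite !Cmod_mult.
    replace (q ^ n)%R with (sqrt q ^ n * sqrt q ^ n)%R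
      by (rewrite <- Rpow_mult_distr, sqrt_sqrt by lra; reflexivity).
    eapply Rle_trans.
    { apply Rmult_le_compat; [apply Cmod_ge_0 | apply Cmod_ge_0 | apply HL | apply HK]. }
    apply Req_le. unfold poch_prod. ring.
Qed.

Lemma poch_1 (n : nat) : poch 1 n = RtoC (INR (Factorial.fact n)).
Proof.
  induction n as [|n IH]; [reflexivity|].
  change (poch 1 (S n)) with (poch 1 n * (1 + RtoC (INR n))).
  rewrite IH, fact_simpl, mult_INR, S_INR, RtoC_mult, RtoC_plus. ring.
Qed.

(** One term of the binomial expansion of [(s1 + s2) ^ (n1 + n2)] is at most the
    whole sum; the denominators are cleared. *)
Lemma multinomial_le (s1 s2 : R) (n1 n2 : nat) : (0 <= s1)%R -> (0 <= s2)%R ->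
  (INR (Factorial.fact (n1 + n2)) * s1 ^ n1 * s2 ^ n2
   <= INR (Factorial.fact n1) * INR (Factorial.fact n2) * (s1 + s2) ^ (n1 + n2))%R.
Proof.
  intros H1 H2. rewrite binomial.
  assert (Hpos : forall n, (0 < INR (Factorial.fact n))%R) by (intros; apply INR_fact_lt_0).
  assert (Hterm : forall i, (0 <= Binomial.C (n1 + n2) i * s1 ^ i * s2 ^ (n1 + n2 - i))%R).
  { intros i. apply Rmult_le_pos; [apply Rmult_le_pos|]; try now apply pow_le.
    unfold Binomial.C. apply Rlt_le, Rdiv_lt_0_compat; [apply Hpos|].
    now apply Rmult_lt_0_compat. }
  assert (Hle : forall (u : nat -> R) (i n : nat), (forall j, (0 <= u j)%R) -> (i <= n)%nat ->
             (u i <= sum_f_R0 u n)%R).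
  { intros u i n Hu Hi. induction n as [|n IH].
    - replace i with O by lia. simpl. lra.
    - simpl. destruct (Nat.eq_dec i (S n)) as [->|Hne].
      + pose proof (cond_pos_sum u n Hu). lra.
      + specialize (IH ltac:(lia)). specialize (Hu (S n)). lra. }
  pose proof (Hle _ n1 (n1 + n2)%nat Hterm ltac:(lia)) as H. cbv beta in H.
  replace (n1 + n2 - n1)%nat with n2 in H by lia.
  eapply Rle_trans; [|apply Rmult_le_compat_l; [|exact H]].
  - apply Req_le. unfold Binomial.C. replace (n1 + n2 - n1)%nat with n2 by lia.
    field. pose proof (Hpos n1). pose proof (Hpos n2). lra.
  - apply Rlt_le, Rmult_lt_0_compat; apply Hpos.
Qed.

(** * The domain *)

Lemma cbrt_spec (r : R) : (0 <= r)%R -> (0 <= cbrt r)%R /\ (cbrt r ^ 3)%R = r.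
Proof.
  intros Hr. unfold cbrt. destruct (Rle_dec r 0) as [H|H].
  - split; [lra|]. simpl. lra.
  - split; [left; apply exp_pos|].
    rewrite <- Rpower_pow by apply exp_pos. rewrite Rpower_mult.
    replace (1 / 3 * INR 3)%R with 1%R by (simpl; field). apply Rpower_1. lra.
Qed.

(** Cube roots are traded for cubes of auxiliary radii, which are easier to
    enlarge. *)
Lemma F_domain_iff (x1 x2 : C) : F_domain x1 x2 <->
  exists s1 s2 : R, (0 <= s1)%R /\ (0 <= s2)%R /\
    (Cmod x1 <= s1 ^ 3)%R /\ (Cmod x2 <= s2 ^ 3)%R /\ (s1 + s2 < 1)%R.
Proof.
  destruct (cbrt_spec (Cmod x1) (Cmod_ge_0 x1)) as [P1 E1].
  destruct (cbrt_spec (Cmod x2) (Cmod_ge_0 x2)) as [P2 E2].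
  unfold F_domain. split.
  - intros H. exists (cbrt (Cmod x1)), (cbrt (Cmod x2)). rewrite E1, E2. lra.
  - intros (s1 & s2 & Hs1 & Hs2 & H1 & H2 & H).
    assert (cube : forall s t : R, (0 <= s)%R -> (0 <= t)%R -> (t ^ 3 <= s ^ 3)%R -> (t <= s)%R).
    { intros s t Hs Ht Hst. apply Rnot_lt_le. intros Hlt.
      assert (0 < (t - s) * (t ^ 2 + t * s + s ^ 2))%R
        by (apply Rmult_lt_0_compat; nra).
      lra. }
    rewrite <- E1 in H1. rewrite <- E2 in H2.
    pose proof (cube s1 _ Hs1 P1 H1). pose proof (cube s2 _ Hs2 P2 H2). lra.
Qed.

(** Both the openness of the domain and the enlarged radii in [converges_on] come
    from this margin. *)
Lemma F_domain_margin (x1 x2 : C) : F_domain x1 x2 ->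
  exists s1 s2 d : R, (0 <= s1)%R /\ (0 <= s2)%R /\ (0 < d)%R /\
    (Cmod x1 + d <= s1 ^ 3)%R /\ (Cmod x2 + d <= s2 ^ 3)%R /\ (0 < s1 + s2 < 1)%R.
Proof.
  intros H. apply F_domain_iff in H. destruct H as (s1 & s2 & Hs1 & Hs2 & H1 & H2 & H).
  (* Adding [e] to both radii keeps half of the distance to [1] and raises each
     cube by at least [e ^ 3]. *)
  set (e := ((1 - s1 - s2) / 4)%R). assert (He : (0 < e)%R) by (unfold e; lra).
  assert (grow : forall s, (0 <= s)%R -> (s ^ 3 + e ^ 3 <= (s + e) ^ 3)%R).
  { intros s Hs.
    replace ((s + e) ^ 3)%R with (s ^ 3 + e ^ 3 + 3 * s * e * (s + e))%R by ring.
    assert (0 <= 3 * s * e * (s + e))%R by (repeat apply Rmult_le_pos; lra). lra. }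
  exists (s1 + e)%R, (s2 + e)%R, (e ^ 3)%R.
  pose proof (grow s1 Hs1). pose proof (grow s2 Hs2).
  repeat split; try lra; [now apply pow_lt | unfold e in *; lra].
Qed.

Lemma slice_open_F_domain : slice_open F_domain.
Proof.
  intros x1 x2 H.
  destruct (F_domain_margin x1 x2 H) as (s1 & s2 & d & Hs1 & Hs2 & Hd & H1 & H2 & Hs).
  exists d. split; [exact Hd|]. intros y.
  assert (near : forall x : C, (Cmod (y - x) < d)%R -> (Cmod y <= Cmod x + d)%R).
  { intros x Hx. pose proof (Cmod_triangle x (y - x)) as T.
    replace (x + (y - x)) with y in T by ring. lra. }
  split; intros Hy; apply near in Hy; apply F_domain_iff; exists s1, s2; repeat split; lra.
Qed.

(** * Convergence and the differential equations *)

(** All Pochhammer symbols are compared with [(1, n) = n!]: the three in the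
    numerator from above, the six in the denominator from below.  The first
    contribute [q ^ (n1 + n2)], the second [q ^ n1] and [q ^ n2]. *)
Lemma hypergeom_coeff_bound (a B1 B2 : list C) (q : R) :
  length a = 3%nat -> length B1 = 3%nat -> length B2 = 3%nat ->
  List.Forall non_pole B1 -> List.Forall non_pole B2 -> (1 < q)%R ->
  exists K, (0 <= K)%R /\ forall n1 n2,
    (Cmod (hypergeom_coeff a B1 B2 n1 n2)
       * (INR (Factorial.fact n1) * INR (Factorial.fact n2)) ^ 3
     <= K * (q ^ 2) ^ (n1 + n2) * INR (Factorial.fact (n1 + n2)) ^ 3)%R.
Proof.
  intros La L1 L2 H1 H2 Hq.
  set (ones := [RtoC 1; RtoC 1; RtoC 1]).
  assert (Hones : List.Forall non_pole ones) by (repeat constructor; apply non_pole_1).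
  assert (Eones : forall n, Cmod (poch_prod ones n) = (INR (Factorial.fact n) ^ 3)%R).
  { intros n. simpl. rewrite poch_1, !Cmod_mult, Cmod_1, !Cmod_R, Rabs_pos_eq by apply pos_INR.
    ring. }
  destruct (poch_prod_ratio_bound a ones q ltac:(now rewrite La) Hones Hq) as (Ka & Ka0 & Ha).
  destruct (poch_prod_ratio_bound ones B1 q ltac:(now rewrite L1) H1 Hq) as (K1 & K10 & HK1).
  destruct (poch_prod_ratio_bound ones B2 q ltac:(now rewrite L2) H2 Hq) as (K2 & K20 & HK2).
  exists (Ka * (K1 * K2))%R. split; [now repeat apply Rmult_le_pos|]. intros n1 n2.
  specialize (Ha (n1 + n2)%nat). specialize (HK1 n1). specialize (HK2 n2).
  rewrite Eones in *.
  pose proof (proj1 (Cmod_gt_0 _) (poch_prod_nonzero B1 n1 H1)) as P1.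
  pose proof (proj1 (Cmod_gt_0 _) (poch_prod_nonzero B2 n2 H2)) as P2.
  assert (Pf : forall n, (0 <= INR (Factorial.fact n) ^ 3)%R)
    by (intros; apply pow_le, pos_INR).
  unfold hypergeom_coeff.
  rewrite Cmod_div by (apply Cmult_neq_0; now apply poch_prod_nonzero).
  rewrite Cmod_mult, Rpow_mult_distr.
  apply Rle_trans with
    ((Ka * q ^ (n1 + n2) * INR (Factorial.fact (n1 + n2)) ^ 3)
       / (Cmod (poch_prod B1 n1) * Cmod (poch_prod B2 n2))
     * ((K1 * q ^ n1 * Cmod (poch_prod B1 n1)) * (K2 * q ^ n2 * Cmod (poch_prod B2 n2))))%R.
  - apply Rmult_le_compat.
    + apply Rdiv_le_0_compat; [apply Cmod_ge_0 | now apply Rmult_lt_0_compat].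
    + apply Rmult_le_pos; apply Pf.
    + apply Rmult_le_compat_r; [|exact Ha].
      apply Rlt_le, Rinv_0_lt_compat. now apply Rmult_lt_0_compat.
    + apply Rmult_le_compat; try assumption; apply Pf.
  - apply Req_le. rewrite <- pow_mult, Nat.mul_comm, pow_mult, <- Rsqr_pow2.
    unfold Rsqr. rewrite !pow_add. field. lra.
Qed.

(** The factor [q ^ 2] lost in [hypergeom_coeff_bound] is absorbed by the slack in
    [s1 + s2 < 1]. *)
Lemma hypergeom_coeff_converges (a B1 B2 : list C) :
  length a = 3%nat -> length B1 = 3%nat -> length B2 = 3%nat ->
  List.Forall non_pole B1 -> List.Forall non_pole B2 ->
  converges_on F_domain (hypergeom_coeff a B1 B2).
Proof.
  intros La L1 L2 HB1 HB2 x1 x2 Hx.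
  destruct (F_domain_margin x1 x2 Hx) as (s1 & s2 & d & Hs1 & Hs2 & Hd & H1 & H2 & Hs).
  (* With [s] for the sum, [q = 2 / (1 + s)] exceeds [1], while
     [q ^ 2 * s = 4 s / (1 + s) ^ 2] stays below [1] since [(1 - s) ^ 2 > 0]. *)
  set (s := (s1 + s2)%R) in *. set (q := (2 / (1 + s))%R).
  assert (Hq : (1 < q)%R) by (apply Rlt_div_r; lra).
  destruct (hypergeom_coeff_bound a B1 B2 q La L1 L2 HB1 HB2 Hq) as (K & HK0 & HK).
  exists d, K, (q ^ 2 * s ^ 3)%R. split; [exact Hd|].
  assert (Hqs : (q ^ 2 * s < 1)%R).
  { replace (q ^ 2 * s)%R with (4 * s / (1 + s) ^ 2)%R by (unfold q; field; lra).
    apply Rlt_div_l; [apply pow_lt; lra|]. nra. }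
  assert (Hq2 : (0 < q ^ 2)%R) by (apply pow_lt; lra).
  split.
  { split; [apply Rmult_lt_0_compat; [exact Hq2 | apply pow_lt; lra]|].
    apply Rle_lt_trans with (q ^ 2 * s)%R; [|exact Hqs].
    apply Rmult_le_compat_l; [lra|]. simpl. nra. }
  intros n1 n2. specialize (HK n1 n2).
  pose proof (multinomial_le s1 s2 n1 n2 Hs1 Hs2) as Hm. fold s in Hm.
  set (c := Cmod (hypergeom_coeff a B1 B2 n1 n2)) in *.
  assert (Hc : (0 <= c)%R) by apply Cmod_ge_0.
  set (f := (INR (Factorial.fact n1) * INR (Factorial.fact n2))%R) in *.
  assert (Hf : (0 < f)%R) by (apply Rmult_lt_0_compat; apply INR_fact_lt_0).
  set (g := INR (Factorial.fact (n1 + n2))) in *.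
  assert (Hg : (0 < g)%R) by apply INR_fact_lt_0.
  pose proof (Cmod_ge_0 x1). pose proof (Cmod_ge_0 x2).
  set (u := (s1 ^ n1 * s2 ^ n2)%R).
  assert (Hu : (0 <= u)%R) by (apply Rmult_le_pos; now apply pow_le).
  apply Rle_trans with (c * u ^ 3)%R.
  { unfold u. rewrite Rpow_mult_distr, <- !pow_mult, !(Nat.mul_comm _ 3), !pow_mult.
    rewrite Rmult_assoc. apply Rmult_le_compat_l; [exact Hc|].
    apply Rmult_le_compat; try (apply pow_le; lra); apply pow_incr; lra. }
  apply Rmult_le_reg_r with (f ^ 3)%R; [now apply pow_lt|].
  apply Rle_trans with (K * (q ^ 2) ^ (n1 + n2) * (g * u) ^ 3)%R.
  { replace (c * u ^ 3 * f ^ 3)%R with (c * f ^ 3 * u ^ 3)%R by ring.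
    rewrite (Rpow_mult_distr g), <- Rmult_assoc.
    apply Rmult_le_compat_r; [now apply pow_le | exact HK]. }
  apply Rle_trans with (K * (q ^ 2) ^ (n1 + n2) * (f * s ^ (n1 + n2)) ^ 3)%R.
  { apply Rmult_le_compat_l; [apply Rmult_le_pos; [exact HK0 | apply pow_le; lra]|].
    apply pow_incr. split; [now apply Rmult_le_pos; [lra|]|].
    unfold u. rewrite <- Rmult_assoc. exact Hm. }
  apply Req_le.
  rewrite (Rmult_assoc K (_ ^ n1)), <- pow_add, !Rpow_mult_distr, <- !pow_mult.
  rewrite (Nat.mul_comm (n1 + n2) 3). ring.
Qed.

Theorem proposition2p3 (a1 a2 a3 b1 b2 b3 b4 : C)
    (hb1 : non_pole b1) (hb2 : non_pole b2)
    (hb3 : non_pole b3) (hb4 : non_pole b4) :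
  let a := [a1; a2; a3] in
  let B1 := [b1; b2; RtoC 1] in
  let B2 := [b3; b4; RtoC 1] in
  let f := F a B1 B2 in
  (forall x1 x2 : C, F_domain x1 x2 -> abs_summable2 (F_term a B1 B2 x1 x2)) /\
  C_derivable_upto 3 F_domain f /\
  (forall x1 x2 : C, F_domain x1 x2 ->
     op_prod (map (fun b => op_add (op_const (b - 1)) theta1) B1) f x1 x2 =
     op_comp op_x1
       (op_prod (map (fun c => op_add (op_const c) (op_add theta1 theta2)) a))
       f x1 x2) /\
  (forall x1 x2 : C, F_domain x1 x2 ->
     op_prod (map (fun b => op_add (op_const (b - 1)) theta2) B2) f x1 x2 =
     op_comp op_x2
       (op_prod (map (fun c => op_add (op_const c) (op_add theta1 theta2)) a))
       f x1 x2).
Proof.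
  intros a B1 B2 f.
  assert (HB1 : List.Forall non_pole B1) by (repeat constructor; try assumption; apply non_pole_1).
  assert (HB2 : List.Forall non_pole B2) by (repeat constructor; try assumption; apply non_pole_1).
  assert (Hone1 : In (RtoC 1) B1) by (simpl; tauto).
  assert (Hone2 : In (RtoC 1) B2) by (simpl; tauto).
  assert (Hconv := hypergeom_coeff_converges a B1 B2 eq_refl eq_refl eq_refl HB1 HB2).
  set (c := hypergeom_coeff a B1 B2) in *.
  assert (Hf : represents F_domain f c) by (split; [exact Hconv | reflexivity]).
  pose proof slice_open_F_domain as HD.
  pose proof (has_symbol_theta1 F_domain HD) as S1.
  pose proof (has_symbol_theta2 F_domain HD) as S2.
  assert (Srow : forall (T : Op) (m : nat -> nat -> C) (B : list C), has_symbol F_domain T m ->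
            has_symbol F_domain (op_prod (map (fun b => op_add (op_const (b - 1)) T) B))
              (fun n1 n2 => shifted_prod B (m n1 n2 - 1))).
  { intros T m B HT.
    apply (has_symbol_prod F_domain _ (fun n1 n2 => m n1 n2 - 1)). intros b g e Hg.
    apply represents_ext
      with (2 := has_symbol_add _ _ _ _ _ (has_symbol_const _ (b - 1)) HT g e Hg).
    intros. ring. }
  assert (Scol : has_symbol F_domain
            (op_prod (map (fun c => op_add (op_const c) (op_add theta1 theta2)) a))
            (fun n1 n2 => shifted_prod a (RtoC (INR n1) + RtoC (INR n2)))).
  { apply (has_symbol_prod F_domain _ (fun n1 n2 => RtoC (INR n1) + RtoC (INR n2))).
    intros b. exact (has_symbol_add _ _ _ _ _ (has_symbol_const _ b)
                       (has_symbol_add _ _ _ _ _ S1 S2)). }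
  split; [|split; [|split]].
  - intros x1 x2 Hx.
    destruct (converges_on_geom_bounded F_domain c x1 x2 Hconv Hx) as (M & rho & Hr & H).
    exact (geom_bounded2_abs_summable M rho _ Hr H).
  - exact (represents_derivable_upto F_domain 3 HD f c Hf).
  - intros x1 x2 Hx.
    rewrite (proj2 (Srow _ _ B1 S1 f c Hf) x1 x2 Hx).
    unfold op_comp at 1. rewrite (proj2 (represents_x1 _ _ _ (Scol f c Hf)) x1 x2 Hx).
    apply power_series2_ext. intros n1 n2. now apply hypergeom_coeff_balance.
  - intros x1 x2 Hx.
    rewrite (proj2 (Srow _ _ B2 S2 f c Hf) x1 x2 Hx).
    unfold op_comp at 1. rewrite (proj2 (represents_x2 _ _ _ (Scol f c Hf)) x1 x2 Hx).
    apply power_series2_ext. intros n1 n2. unfold c.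
    rewrite hypergeom_coeff_transpose, hypergeom_coeff_balance by assumption.
    destruct n2 as [|n2]; [reflexivity|]. simpl.
    now rewrite hypergeom_coeff_transpose, (Cplus_comm (RtoC (INR n2))).
Qed.
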